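(* Let $X$ be a Banach space and let $1\le p\le 2$. Then $$ T_p^R(X)\le T_p^E(X)\le p\,T_p^R(X). $$ In particular, Rademacher type $p$ and Enflo type $p$ coincide, i.e. $X$ has Rademacher type $p$ if and only if $X$ has Enflo type $p$.
   Context: Let $(X,\|\cdot\|_X)$ be a Banach space and $p\in[1,2]$. Expectations $\mathbb E_\varepsilon$ are over $\varepsilon=(\varepsilon_1,\ldots,\varepsilon_n)$ uniformly distributed on $\{-1,1\}^n$ (independent Rademacher variables). For $f:\{-1,1\}^n\to X$ and $j\in\{1,\ldots,n\}$, $D_jf(\varepsilon)=\frac{f(\varepsilon)-f(\varepsilon^{(j)})}{2}$, where $\varepsilon^{(j)}$ is $\varepsilon$ with its $j$-th coordinate flipped (multiplied by $-1$). $X$ has Rademacher type $p$ if there exists $C\in(0,\infty)$ such that for every $n\ge1$ and every $x_1,\ldots,x_n\in X$, $$\mathbb E_\varepsilon\Big\|\sum_{j=1}^n\varepsilon_jx_j\Big\|_X^p\le C^p\sum_{j=1}^n\|x_j\|_X^p.$$ $T_p^R(X)$ denotes the smallest possible (i.e. the infimum of all) such constants $C$, with $T_p^R(X)=\infty$ if no such $C$ exists. $X$ has Enflo type $p$ if there exists $C\in(0,\infty)$ such that for every $n\ge1$ and every function $f:\{-1,1\}^n\to X$, $$\mathbb E_\varepsilon\Big\|\frac{f(\varepsilon)-f(-\varepsilon)}{2}\Big\|_X^p\le C^p\sum_{j=1}^n\mathbb E_\varepsilon\|D_jf(\varepsilon)\|_X^p.$$ $T_p^E(X)$ denotes the smallest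 possible (i.e. the infimum of all) such constants $C$, with $T_p^E(X)=\infty$ if no such $C$ exists. *)

(* Defs.v *)
From HB Require Import structures.
From mathcomp Require Import all_boot all_order all_algebra.
From mathcomp Require Import all_classical all_reals all_analysis.

Set Implicit Arguments.
Unset Strict Implicit.
Unset Printing Implicit Defensive.

Import Order.TTheory GRing.Theory Num.Theory.
Import numFieldNormedType.Exports.

Local Open Scope classical_set_scope.
Local Open Scope ring_scope.

(* {-1,1}^n, with the boolean b standing for the sign (-1)^b *)
Notation cube n := {ffun 'I_n -> bool}.

Section Cube.
Context {n : nat}.

Definition rademacher (R : realType) (e : cube n) (j : 'I_n) : R :=
  (-1) ^+ e j.

Definition flip (j : 'I_n) (e : cube n) : cube n :=
  [ffun i => if i == j then ~~ e i else e i].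

Definition antipode (e : cube n) : cube n := [ffun i => ~~ e i].

Definition cubeE (R : realType) (F : cube n -> R) : R :=
  (2 ^+ n)^-1 * \sum_(e : cube n) F e.

Definition cubeD (R : realType) (X : normedModType R)
    (j : 'I_n) (f : cube n -> X) (e : cube n) : X :=
  2^-1 *: (f e - f (flip j e)).

End Cube.

Section Types.
Context {R : realType} (X : normedModType R) (p : R).

Definition rademacher_type_const (C : R) : Prop :=
  0 < C /\
  forall (n : nat) (x : 'I_n -> X), (0 < n)%N ->
    cubeE (fun e => `| \sum_(j < n) rademacher R e j *: x j | `^ p)
      <= C `^ p * \sum_(j < n) `| x j | `^ p.

Definition enflo_type_const (C : R) : Prop :=
  0 < C /\
  forall (n : nat) (f : cube n -> X), (0 < n)%N ->
    cubeE (fun e => `| 2^-1 *: (f e - f (antipode e)) | `^ p)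
      <= C `^ p * \sum_(j < n) cubeE (fun e => `| cubeD j f e | `^ p).

Definition has_rademacher_type : Prop := exists C : R, rademacher_type_const C.

Definition has_enflo_type : Prop := exists C : R, enflo_type_const C.

(* +oo when there is no admissible constant, as the infimum of the empty set *)
Definition rademacher_const : \bar R :=
  ereal_inf [set C%:E | C in rademacher_type_const].

Definition enflo_const : \bar R :=
  ereal_inf [set C%:E | C in enflo_type_const].

End Types.

(* Main.v *)
Require Import Defs.
From HB Require Import structures.
From mathcomp Require Import all_boot all_order all_algebra.
From mathcomp Require Import all_classical all_reals all_analysis.
From mathcomp Require Import ring lra.

Local Open Scope ring_scope.

Import Order.TTheory GRing.Theory Num.Theory.
Import numFieldNormedType.Exports.
Set Implicit Arguments.
Unset Strict Implicit.
Unset Printing Implicit Defensive.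

(** Enflo's inequality follows from Rademacher type by interpolating between the
    odd part [g] of [f] and its mean.  Let [K_rho] be the noise
    kernel [prod_j (1 + rho e_j d_j) / 2] and [T_rho g] the corresponding
    average of [g].  Then [T_1 g = g], while [T_0 g] is the mean of [g], which
    is [0] because [g] is odd.  So the Lp norm of [g] is at most the integral
    over [0, 1] of the Lp norm of the derivative of [T_rho g].

    To realise the noise, resample each coordinate of [e] independently with
    probability [1 - rho]: [eta_j] says whether coordinate [j] is resampled,
    and [s_j] is the independent sign that then multiplies [e_j].  If [x] is
    the resulting point, the derivative is
    [(1 - rho)^-1 E_(eta,s) sum_j eta_j s_j D_j g(x)]
    ([noise_deriv_randomized]).  For fixed [eta] and [s] the map from [e] to
    [x] is a bijection of the cube, so after Jensen's inequality [D_j g(x)] may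
    be replaced by [D_j g(e)], which is independent of [s].  Rademacher type is
    then applied to the vectors [eta_j D_j g(e)], and only a proportion
    [1 - rho] of them survives on average ([randomized_gradient_bound]).  This
    gives the bound [C (1 - rho)^(1/p - 1) (sum_j E |D_j g|^p)^(1/p)] for the
    derivative, and the integral of [(1 - rho)^(1/p - 1)] over [0, 1] is [p].
    The sampling by a lazy resampling, rather than by centred biased signs, is
    what makes the constant exactly [p].

    Since [T_rho g] is polynomial in [rho], the integration is elementary: over
    a small interval the derivative bound holds up to a quadratic error, and
    concavity of [x^(1/p)] bounds it by an increment of
    [- p (1 - rho)^(1/p)]; the increments telescope and the quadratic errors
    vanish as the partition is refined ([odd_lpnorm_le_gradient]).

    The converse direction is Enflo's inequality for the linear function
    [e |-> sum_j e_j x_j], which is odd with [|D_j f| = |x_j|]. *)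

(** * Inequalities for powers *)

Section PowerInequalities.
Context {R : realType} (p : R).
Context (p_ge1 : 1 <= p).

Let p_gt0 : 0 < p. Proof. exact: lt_le_trans p_ge1. Qed.
Let p_neq0 : p != 0. Proof. by rewrite gt_eqF. Qed.
Let pV_neq0 : p^-1 != 0. Proof. by rewrite invr_eq0. Qed.

Lemma powRVK (x : R) : 0 <= x -> (x `^ p^-1) `^ p = x.
Proof. by move=> x_ge0; rewrite -powRrM mulVf// powRr1. Qed.

Lemma powRKV (x : R) : 0 <= x -> (x `^ p) `^ p^-1 = x.
Proof. by move=> x_ge0; rewrite -powRrM mulfV// powRr1. Qed.

Lemma ler_powRp (x y : R) : 0 <= x -> x <= y -> x `^ p <= y `^ p.
Proof.
move=> x0 xy; apply: ge0_ler_powR; rewrite ?nnegrE ?(ltW p_gt0)//.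
exact: le_trans xy.
Qed.

Lemma ler_powRV (x y : R) : 0 <= x -> x <= y -> x `^ p^-1 <= y `^ p^-1.
Proof.
move=> x0 xy; apply: ge0_ler_powR; rewrite ?nnegrE ?invr_ge0 ?(ltW p_gt0)//.
exact: le_trans xy.
Qed.

(** This is convexity of the exponential at the points [p * ln s] and [0],
    taken with weights [1 / p] and [1 - 1 / p]. *)
Lemma bernoulli_powR (s : R) : 0 <= s -> 1 + p * (s - 1) <= s `^ p.
Proof.
rewrite le_eqVlt => /predU1P[<-|s_gt0].
  by rewrite powR0//; move: p_ge1; lra.
have pV01 : 0 <= p^-1 <= 1 by rewrite invr_ge0 ltW//= invf_le1.
have /andP[pV0 pV1] := pV01.
have := convex_expR (Itv01 pV0 pV1) (p * ln s : R^o) 0.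
rewrite [X in expR X <= _ -> _]convRE [X in _ <= X -> _]convRE /=.
rewrite mulr0 addr0 mulrA mulVf// mul1r lnK ?posrE// expR0 mulr1.
rewrite /powR gt_eqF// -(ler_pM2l p_gt0) mulrDr mulrA mulfV// mul1r.
rewrite mulrBr mulr1 mulfV//; move: (expR _) => x; lra.
Qed.

(** The tangent line at [u] of the concave function [x |-> x^(1/p)]; with
    [u = 1 - a] and [v = 1 - b] it compares a left Riemann sum of
    [(1 - rho)^(1/p - 1)] with a telescoping sum. *)
Lemma concave_powRV_increment (u v : R) : 0 < u -> 0 <= v -> v <= u ->
  (u - v) * (u^-1 * u `^ p^-1) <= p * (u `^ p^-1 - v `^ p^-1).
Proof.
move=> u0 v0 vu.
have vu0 : 0 <= v / u by rewrite divr_ge0// ltW.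
have -> : v `^ p^-1 = (v / u) `^ p^-1 * u `^ p^-1.
  by rewrite -powRM ?(ltW u0)// divfK// gt_eqF.
have := bernoulli_powR (powR_ge0 (v / u) p^-1); rewrite powRVK//.
set s := (v / u) `^ p^-1; set t := u `^ p^-1 => h.
have t0 : 0 <= t by exact: powR_ge0.
have -> : (u - v) * (u^-1 * t) = (1 - v / u) * t by field; rewrite gt_eqF.
have -> : p * (t - s * t) = (p * (1 - s)) * t by ring.
apply: ler_wpM2r => //; lra.
Qed.

(** At the mean [m] of [c], the Bernoulli inequality for [c i / m] is the
    supporting line of the power function; its linear part averages
    to zero. *)
Lemma jensen_powR (I : finType) (w c : I -> R) :
  (forall i, 0 <= w i) -> \sum_i w i = 1 -> (forall i, 0 <= c i) ->
  (\sum_i w i * c i) `^ p <= \sum_i w i * c i `^ p.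
Proof.
move=> w0 w1 c0; set m := \sum_i _.
have : 0 <= m by apply: sumr_ge0 => i _; rewrite mulr_ge0.
rewrite le_eqVlt => /predU1P[<-|m0].
  by rewrite powR0//; apply: sumr_ge0 => i _; rewrite mulr_ge0 ?powR_ge0.
have mp0 : 0 < m `^ p by rewrite powR_gt0.
have -> : m `^ p = \sum_i w i * (m `^ p * (1 + p * (c i / m - 1))).
  under eq_bigr do rewrite mulrCA.
  rewrite -mulr_sumr.
  have -> : \sum_i w i * (1 + p * (c i / m - 1)) =
      (1 - p) * \sum_i w i + p / m * \sum_i w i * c i.
    by rewrite !mulr_sumr -big_split; apply: eq_bigr => i _ /=; ring.
  by rewrite w1 -/m divfK ?gt_eqF// mulr1 subrK mulr1.
apply: ler_sum => i _; apply: ler_wpM2l => //.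
have cE : c i = m * (c i / m) by rewrite mulrC divfK// gt_eqF.
have ci0 : 0 <= c i / m by rewrite divr_ge0// ltW.
rewrite [in leRHS]cE powRM ?(ltW m0)//.
by apply: ler_wpM2l; [exact: ltW|exact: bernoulli_powR].
Qed.

(** With [A] and [B] the two norms on the right, [(a + b) / (A + B)] is the
    average of [a / A] and [b / B] with weights proportional to [A] and [B],
    so Jensen applies termwise. *)
Lemma minkowski_sum_powR (I : finType) (a b : I -> R) :
  (forall i, 0 <= a i) -> (forall i, 0 <= b i) ->
  (\sum_i (a i + b i) `^ p) `^ p^-1 <=
  (\sum_i a i `^ p) `^ p^-1 + (\sum_i b i `^ p) `^ p^-1.
Proof.
move=> a0 b0.
move AE: ((\sum_i a i `^ p) `^ _) => A; move BE: ((\sum_i b i `^ p) `^ _) => B.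
have S0 (d : I -> R) : 0 <= \sum_i d i `^ p.
  by apply: sumr_ge0 => i _; exact: powR_ge0.
have norm0 (d : I -> R) : (forall i, 0 <= d i) ->
    (\sum_i d i `^ p) `^ p^-1 = 0 -> forall i, d i = 0.
  move=> d0 /powR_eq0_eq0 /eqP; rewrite psumr_eq0; last first.
    by move=> i _; exact: powR_ge0.
  move=> /allP h i.
  by have /eqP/powR_eq0_eq0 := h i (mem_index_enum _).
have : 0 <= A by rewrite -AE powR_ge0.
rewrite le_eqVlt => /predU1P[Az|A0].
  rewrite -Az add0r -BE.
  under eq_bigr do rewrite (norm0 _ a0 (etrans AE (esym Az))) add0r.
  exact: lexx.
have : 0 <= B by rewrite -BE powR_ge0.
rewrite le_eqVlt => /predU1P[Bz|B0].
  rewrite -Bz addr0 -AE.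
  under eq_bigr do rewrite (norm0 _ b0 (etrans BE (esym Bz))) addr0.
  exact: lexx.
have AB0 : 0 < A + B by exact: addr_gt0.
rewrite -[leRHS]powRKV ?(ltW AB0)//; apply: ler_powRV => //.
pose w (k : bool) := (if k then A else B) / (A + B).
have w0 k : 0 <= w k by rewrite /w divr_ge0 ?(ltW AB0)//; case: k; exact: ltW.
have w1 : \sum_k w k = 1 by rewrite big_bool /= /w -mulrDl mulfV// gt_eqF.
have key i : (a i + b i) `^ p <=
    (A + B) `^ p * (w true * (a i `^ p / A `^ p) + w false * (b i `^ p / B `^ p)).
  pose c (k : bool) := if k then a i / A else b i / B.
  have c0 k : 0 <= c k by rewrite /c; case: k; rewrite divr_ge0// ltW.
  have := jensen_powR w0 w1 c0; rewrite !big_bool /=.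
  have -> : w true * (a i / A) + w false * (b i / B) = (A + B)^-1 * (a i + b i).
    by rewrite /w; field; rewrite !gt_eqF.
  have cp x y : 0 <= x -> 0 < y -> (x / y) `^ p = x `^ p / y `^ p.
    move=> x0 /ltW y0; rewrite powRM ?invr_ge0// -[y^-1]powR_inv1//.
    by rewrite powRAC powR_inv1 ?powR_ge0.
  rewrite !cp// (mulrC (A + B)^-1) cp ?addr_ge0// ler_pdivrMr ?powR_gt0//.
  by rewrite mulrC.
apply: le_trans (ler_sum _ (fun i _ => key i)) _.
rewrite -mulr_sumr big_split /= -!mulr_sumr -!mulr_suml.
have Ap : A `^ p = \sum_i a i `^ p by rewrite -AE powRVK.
have Bp : B `^ p = \sum_i b i `^ p by rewrite -BE powRVK.
rewrite -Ap -Bp !mulfV ?gt_eqF ?powR_gt0// !mulr1.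
by move: w1; rewrite big_bool /= => ->; rewrite mulr1.
Qed.

End PowerInequalities.

(** On a partition of [0, 1] into [N] equal steps the errors add up to
    [M / N]. Increments take the place of derivatives because a norm need not be
    differentiable along a smooth path. *)
Lemma le_of_quadratic_increments {R : realType} (h : R -> R) (M : R) :
  (forall a b, 0 <= a -> a < b -> b <= 1 -> h b - h a <= M * (b - a) ^+ 2) ->
  h 1 <= h 0.
Proof.
move=> hM; apply/ler_addgt0Pr => e e0.
pose N := (Num.truncn (`|M| / e)).+1.
have N0 : 0 < N%:R :> R by rewrite ltr0n.
have Nn0 : N%:R != 0 :> R by rewrite gt_eqF.
have MN : M / N%:R <= e.
  rewrite ler_pdivrMr// -ler_pdivrMl// mulrC.
  apply: le_trans (ltW (truncnS_gt _)); rewrite ler_pM2r ?invr_gt0//.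
  exact: ler_norm.
pose t (k : nat) : R := k%:R / N%:R.
have hs : h (t N) - h (t 0%N) <= \sum_(0 <= k < N) M / N%:R ^+ 2.
  rewrite -(telescope_sumr (h \o t))//; apply: ler_sum_nat => k /andP[_ kN] /=.
  have tS : t k.+1 - t k = N%:R^-1 by rewrite /t -mulrBl -natrB// subSnn mul1r.
  have -> : M / N%:R ^+ 2 = M * (t k.+1 - t k) ^+ 2 by rewrite tS exprVn.
  apply: hM.
  - by rewrite /t divr_ge0.
  - by rewrite -subr_gt0 tS invr_gt0.
  - by rewrite /t ler_pdivrMr// mul1r ler_nat.
move: hs; rewrite sumr_const_nat subn0 /t mulfV// mul0r.
have -> : M / N%:R ^+ 2 *+ N = M / N%:R by rewrite -mulr_natr; field.
by move=> hs; lra.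
Qed.

(** * Expectations and Lp norms on the cube *)

Section CubeExpectation.
Context {R : realType} {n : nat}.
Implicit Types F G : cube n -> R.

Lemma cubeE_reindex (s : cube n -> cube n) F :
  injective s -> cubeE (F \o s) = cubeE F.
Proof. by move=> s_inj; rewrite /cubeE [in RHS](reindex_inj s_inj). Qed.

Lemma ler_cubeE F G : (forall e, F e <= G e) -> cubeE F <= cubeE G.
Proof.
move=> FG; apply: ler_wpM2l; first by rewrite invr_ge0 exprn_ge0.
by apply: ler_sum => e _; exact: FG.
Qed.

Lemma eq_cubeE F G : (forall e, F e = G e) -> cubeE F = cubeE G.
Proof. by move=> FG; congr cubeE; apply/funext. Qed.

Lemma cubeE_ge0 F : (forall e, 0 <= F e) -> 0 <= cubeE F.
Proof.
by move=> F0; rewrite mulr_ge0 ?invr_ge0 ?exprn_ge0// sumr_ge0.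
Qed.

Lemma cubeE_cst (c : R) : cubeE (fun _ : cube n => c) = c.
Proof.
rewrite /cubeE sumr_const card_ffun card_bool card_ord -[c *+ _]mulr_natr natrX.
by rewrite mulrCA mulVf ?mulr1// expf_neq0.
Qed.

Lemma cubeE_sum (I : finType) (w : I -> R) (F : I -> cube n -> R) :
  cubeE (fun e => \sum_i w i * F i e) = \sum_i w i * cubeE (F i).
Proof.
rewrite /cubeE exchange_big mulr_sumr; apply: eq_bigr => i _.
by rewrite -mulr_sumr mulrCA.
Qed.

Lemma flipK (j : 'I_n) : involutive (flip j).
Proof.
move=> e; apply/ffunP => i; rewrite !ffunE.
by case: eqP => // _; rewrite negbK.
Qed.

Lemma antipodeK : involutive (@antipode n).
Proof. by move=> e; apply/ffunP => i; rewrite !ffunE negbK. Qed.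

Lemma antipode_flip (j : 'I_n) (e : cube n) :
  antipode (flip j e) = flip j (antipode e).
Proof. by apply/ffunP => i; rewrite !ffunE; case: eqP. Qed.

Lemma rademacher_flip (j : 'I_n) (e : cube n) :
  rademacher R (flip j e) j = - rademacher R e j.
Proof. by rewrite /rademacher ffunE eqxx signrN. Qed.

Lemma rademacher_flip_neq (i j : 'I_n) (e : cube n) : i != j ->
  rademacher R (flip j e) i = rademacher R e i.
Proof. by rewrite /rademacher ffunE => /negbTE ->. Qed.

Lemma rademacher_antipode (j : 'I_n) (e : cube n) :
  rademacher R (antipode e) j = - rademacher R e j.
Proof. by rewrite /rademacher ffunE signrN. Qed.

End CubeExpectation.

Section LpNorm.
Context {R : realType} (X : normedModType R) (p : R) {n : nat}.
Context (p_ge1 : 1 <= p).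
Implicit Types u v : cube n -> X.

Definition lpnorm u : R := cubeE (fun e => `|u e| `^ p) `^ p^-1.

Let momentp_ge0 u : 0 <= cubeE (fun e => `|u e| `^ p).
Proof. by apply: cubeE_ge0 => e; exact: powR_ge0. Qed.

Lemma lpnorm_powR u : lpnorm u `^ p = cubeE (fun e => `|u e| `^ p).
Proof. by rewrite powRVK. Qed.

Lemma lpnorm_ge0 u : 0 <= lpnorm u. Proof. exact: powR_ge0. Qed.

Lemma eq_lpnorm u v : (forall e, u e = v e) -> lpnorm u = lpnorm v.
Proof. by move=> uv; congr lpnorm; apply/funext. Qed.

Lemma lpnorm_reindex (s : cube n -> cube n) u :
  injective s -> lpnorm (u \o s) = lpnorm u.
Proof. 
by move=> s_inj; congr (_ `^ _); exact: (cubeE_reindex (fun e => `|u e| `^ p)).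
Qed.

Lemma lpnormD u v : lpnorm (fun e => u e + v e) <= lpnorm u + lpnorm v.
Proof.
have split_weight (F : cube n -> R) : (forall e, 0 <= F e) ->
    cubeE F `^ p^-1 = (2 ^+ n)^-1 `^ p^-1 * (\sum_e F e) `^ p^-1.
  by move=> F0; rewrite powRM ?invr_ge0 ?exprn_ge0 ?sumr_ge0.
rewrite /lpnorm !split_weight => [|e|e|e]; try exact: powR_ge0.
rewrite -mulrDr; apply: ler_wpM2l; first exact: powR_ge0.
apply: le_trans _ (minkowski_sum_powR p_ge1
  (fun e => normr_ge0 (u e)) (fun e => normr_ge0 (v e))).
apply: ler_powRV => //; first by apply: sumr_ge0 => e _; exact: powR_ge0.
by apply: ler_sum => e _; apply: ler_powRp => //; exact: ler_normD.
Qed.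

Lemma lpnormZ (c : R) u : lpnorm (fun e => c *: u e) = `|c| * lpnorm u.
Proof.
rewrite /lpnorm; under eq_cubeE do rewrite normrZ powRM//.
have -> : cubeE (fun e => `|c| `^ p * `|u e| `^ p) =
    `|c| `^ p * cubeE (fun e => `|u e| `^ p).
  by rewrite /cubeE -mulr_sumr mulrCA.
by rewrite powRM ?powR_ge0// powRKV.
Qed.

Lemma lpnorm_le_sup (B : R) u : (forall e, `|u e| <= B) -> lpnorm u <= B.
Proof.
move=> uB.
have B0 : 0 <= B by exact: le_trans (uB [ffun=> true]).
rewrite -[leRHS](powRKV p_ge1)// -[B `^ p](cubeE_cst (n := n)).
by apply: ler_powRV => //; apply: ler_cubeE => e; exact: ler_powRp.
Qed.

End LpNorm.

(** * Random resampling of coordinates *)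

Section Noise.
Context {R : realType} {n : nat}.

(** The law of a random set of coordinates that contains each coordinate
    independently with probability [1 - rho]. *)
Definition mask_weight (rho : R) (eta : cube n) : R :=
  \prod_i (if eta i then 1 - rho else rho).

Definition resample (eta s e : cube n) : cube n :=
  [ffun i => e i (+) (eta i && s i)].

Lemma resample_inj (eta s : cube n) : injective (resample eta s).
Proof.
apply: inv_inj => e; apply/ffunP => i.
by rewrite !ffunE -addbA addbb addbF.
Qed.

Lemma mask_weight_ge0 (rho : R) (eta : cube n) : 0 <= rho <= 1 ->
  0 <= mask_weight rho eta.
Proof.
move=> /andP[r0 r1]; apply: prodr_ge0 => i _.
by case: (eta i) => //; rewrite subr_ge0.
Qed.

Lemma sum_mask_weight (rho : R) : \sum_eta mask_weight rho eta = 1.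
Proof.
rewrite -(bigA_distr_bigA (fun i (b : bool) => if b then 1 - rho else rho)) /=.
by rewrite big1// => i _; rewrite big_bool /= subrK.
Qed.

(** The source of the factor [1 - rho] in [randomized_gradient_bound]. *)
Lemma mask_weight_marginal (rho : R) (j : 'I_n) :
  \sum_eta mask_weight rho eta * (eta j)%:R = 1 - rho.
Proof.
pose c (i : 'I_n) (b : bool) : R :=
  (if b then 1 - rho else rho) * (if i == j then b%:R else 1).
have -> : \sum_eta mask_weight rho eta * (eta j)%:R =
    \sum_(eta : cube n) \prod_i c i (eta i).
  apply: eq_bigr => eta _; rewrite /c big_split /=; congr (_ * _).
  by rewrite (bigD1 j)//= eqxx big1 ?mulr1// => i /negbTE ->.
rewrite -bigA_distr_bigA (bigD1 j)//= big_bool /c eqxx /= mulr1 mulr0 addr0.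
by rewrite big1 ?mulr1// => i /negbTE ij; rewrite big_bool /= ij !mulr1 subrK.
Qed.

Context (X : normedModType R) (p : R).
Context (p_ge1 : 1 <= p).

(** For a fixed mask and fixed signs, resampling permutes the cube, so that
    the average over [e] decouples the gradient from the signs; Rademacher
    type is then used pointwise in [e] and in the mask. *)
Lemma randomized_gradient_bound (C rho : R) (g : cube n -> X) :
  (0 < n)%N -> rademacher_type_const X p C -> 0 <= rho <= 1 ->
  cubeE (fun e => `| \sum_(a : cube n * cube n)
      (mask_weight rho a.1 * (2 ^+ n)^-1) *:
      (\sum_j ((a.1 j)%:R * rademacher R a.2 j) *: cubeD j g (resample a.1 a.2 e))
    | `^ p) <=
  C `^ p * ((1 - rho) * \sum_j cubeE (fun e => `|cubeD j g e| `^ p)).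
Proof.
move=> n0 [C0 typeC] rho01.
pose w (a : cube n * cube n) := mask_weight rho a.1 * (2 ^+ n)^-1.
(* the decoupled sum: the gradient is read at [e], not at the resampled point *)
pose v (a : cube n * cube n) e :=
  \sum_j ((a.1 j)%:R * rademacher R a.2 j) *: cubeD j g e.
have w0 a : 0 <= w a by rewrite mulr_ge0 ?mask_weight_ge0 ?invr_ge0 ?exprn_ge0.
have split_w (F : cube n -> cube n -> R) :
    \sum_a w a * F a.1 a.2 = \sum_eta mask_weight rho eta * cubeE (F eta).
  rewrite [RHS](_ : _ = \sum_eta \sum_s w (eta, s) * F eta s).
    by rewrite pair_big.
  by apply: eq_bigr => eta _; rewrite /cubeE mulrA mulr_sumr.
have w1 : \sum_a w a = 1.
  have := split_w (fun _ _ => 1); under eq_bigr do rewrite mulr1.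
  move=> ->; under eq_bigr do rewrite cubeE_cst mulr1.
  exact: sum_mask_weight.
apply: (@le_trans _ _ (cubeE (fun e =>
    \sum_a w a * `|v a (resample a.1 a.2 e)| `^ p))).
  apply: ler_cubeE => e.
  apply: le_trans _ (jensen_powR p_ge1 w0 w1 _) => //.
  apply: ler_powRp => //; apply: le_trans (ler_norm_sum _ _ _) _.
  by apply: ler_sum => a _; rewrite normrZ (ger0_norm (w0 a)).
rewrite cubeE_sum.
under eq_bigr => a _.
  rewrite (cubeE_reindex (fun e => `|v a e| `^ p) (@resample_inj a.1 a.2)).
  over.
rewrite -cubeE_sum.
apply: (@le_trans _ _ (cubeE (fun e => \sum_eta mask_weight rho eta *
    (C `^ p * \sum_j (eta j)%:R * `|cubeD j g e| `^ p)))).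
  apply: ler_cubeE => e.
  rewrite (split_w (fun eta s => `|v (eta, s) e| `^ p)).
  apply: ler_sum => eta _; apply: ler_wpM2l; first exact: mask_weight_ge0.
  have := typeC n (fun j => (eta j)%:R *: cubeD j g e) n0.
  under eq_cubeE => s.
    rewrite (_ : \sum_j _ = v (eta, s) e); last first.
      by apply: eq_bigr => j _; rewrite scalerA mulrC.
    over.
  move=> /le_trans; apply; rewrite ler_wpM2l ?powR_ge0//.
  apply: ler_sum => j _; case: (eta j); first by rewrite scale1r mul1r.
  by rewrite scale0r normr0 mul0r powR0// gt_eqF// (lt_le_trans ltr01).
rewrite cubeE_sum; under eq_bigr => eta _.
  rewrite (_ : cubeE _ = C `^ p *
      \sum_j (eta j)%:R * cubeE (fun e => `|cubeD j g e| `^ p)); last first.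
    by rewrite -cubeE_sum /cubeE -mulr_sumr mulrCA.
  rewrite mulrCA mulr_sumr.
  over.
rewrite -mulr_sumr exchange_big /=; apply: ler_wpM2l; first exact: powR_ge0.
rewrite mulr_sumr; apply: ler_sum => j _; under eq_bigr do rewrite mulrA.
by rewrite -mulr_suml mask_weight_marginal.
Qed.

End Noise.

Lemma scaler_half_double {R : numFieldType} {V : lmodType R} (v : V) :
  2^-1 *: (v + v) = v.
Proof. by rewrite -mulr2n -[v *+ 2]scaler_nat scalerA mulVf ?scale1r. Qed.

(** * First-order expansion of polynomials *)

Section PolynomialExpansion.
Context {R : realType}.
Implicit Types q : {poly R}.

Lemma horner_bounded_itv01 q :
  exists M, forall a, 0 <= a <= 1 -> `|q.[a]| <= M.
Proof.
elim/poly_ind: q => [|q c [M qM]]; first by exists 0 => a _; rewrite horner0 normr0.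
exists (M + `|c|) => a /[dup] a01 /andP[a0 a1]; rewrite hornerMXaddC.
apply: le_trans (ler_normD _ _) _; rewrite lerD2r normrM (ger0_norm a0).
by apply: le_trans (qM _ a01); rewrite ler_piMr.
Qed.

Lemma horner_quadratic_remainder q :
  exists M, forall a b, 0 <= a <= 1 -> 0 <= b <= 1 ->
  `|q.[b] - q.[a] - (b - a) * q^`().[a]| <= M * (b - a) ^+ 2.
Proof.
elim/poly_ind: q => [|q c [M qM]].
  by exists 0 => a b _ _; rewrite deriv0 !horner0 !(subr0, mulr0) normr0 mul0r.
have [M' q'M'] := horner_bounded_itv01 q^`().
exists (M + M') => a b a01 b01.
rewrite derivMXaddC hornerD hornerM hornerX !hornerMXaddC.
have -> : q.[b] * b + c - (q.[a] * a + c) - (b - a) * (q.[a] + q^`().[a] * a) =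
    b * (q.[b] - q.[a] - (b - a) * q^`().[a]) + q^`().[a] * (b - a) ^+ 2.
  by ring.
apply: le_trans (ler_normD _ _) _; rewrite [leRHS]mulrDl; apply: lerD.
  case/andP: (b01) => b0 b1; rewrite normrM (ger0_norm b0).
  by apply: le_trans (qM a b a01 b01); rewrite ler_piMl.
by rewrite normrM (ger0_norm (sqr_ge0 _)) ler_wpM2r ?sqr_ge0// q'M'.
Qed.

Lemma deriv_prod (I : finType) (F : I -> {poly R}) :
  (\prod_i F i)^`() = \sum_j (F j)^`() * \prod_(i | i != j) F i.
Proof.
suff aux (r : seq I) : uniq r -> (\prod_(i <- r) F i)^`() =
    \sum_(j <- r) (F j)^`() * \prod_(i <- r | i != j) F i.
  by rewrite aux ?index_enum_uniq.
elim: r => [_|k r IH /= /andP[kr r_uniq]]; first by rewrite !big_nil derivC.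
rewrite !big_cons eqxx /= derivM IH//; congr (_ * _ + _).
  rewrite -[RHS]big_filter; congr (\big[_/_]_(i <- _) _); symmetry.
  by apply/all_filterP/allP => i ir; apply: contraNneq kr => <-.
rewrite mulr_sumr; apply: eq_big_seq => j jr.
rewrite big_cons ifT; first by rewrite mulrCA.
by apply: contraNneq kr => ->.
Qed.

End PolynomialExpansion.

(** * The noise kernel and its derivative *)

Section NoiseKernel.
Context {R : realType} {n : nat}.

Definition sign_product (e d : cube n) (j : 'I_n) : R := (-1) ^+ (e j (+) d j).

(** The probability that noise of correlation [rho] moves [e] to [d], kept as
    a polynomial in [rho] so that it can be differentiated and expanded
    formally. *)
Definition noise_kernel (e d : cube n) : {poly R} :=
  \prod_j ((2^-1)%:P * (1 + (sign_product e d j)%:P * 'X)).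

Lemma noise_kernel1 (e d : cube n) : (noise_kernel e d).[1] = (e == d)%:R.
Proof.
rewrite /noise_kernel horner_prod; have [<-|] := eqVneq e d.
  rewrite big1// => j _; rewrite !hornerE /sign_product addbb expr0.
  by field.
move=> ed; have [j ej] : exists j, e j != d j.
  apply/existsP; apply: contraNT ed; rewrite negb_exists => /forallP h.
  by apply/eqP/ffunP => j; have := h j; rewrite negbK => /eqP.
rewrite (bigD1 j)//= !hornerE /sign_product.
have -> : e j (+) d j = true by case: (e j) (d j) ej => [] [].
by rewrite expr1 subrr mulr0 mul0r.
Qed.

Lemma noise_kernel0 (e d : cube n) : (noise_kernel e d).[0] = (2 ^+ n)^-1.
Proof.
rewrite /noise_kernel horner_prod.
under eq_bigr do rewrite !hornerE.
by rewrite prodr_const card_ord exprVn.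
Qed.

Lemma deriv_noise_kernel (e d : cube n) (rho : R) :
  (noise_kernel e d)^`().[rho] = \sum_j 2^-1 * sign_product e d j *
     \prod_(i | i != j) (2^-1 * (1 + sign_product e d i * rho)).
Proof.
rewrite /noise_kernel deriv_prod horner_sum; apply: eq_bigr => j _.
rewrite hornerM horner_prod; congr (_ * _).
  rewrite deriv_mulC derivD -polyC1 derivC deriv_mulC derivX add0r mulr1.
  by rewrite hornerM !hornerC.
by apply: eq_bigr => i _; rewrite !hornerE.
Qed.

(** Conditionally on the resampled point being [d], a resampled coordinate [j]
    has sign [s_j = e_j d_j]. All factors are independent, so the sum over
    masks and signs is a product over coordinates: coordinate [j] contributes
    [(1 - rho) / 2 * e_j d_j] and the others the factors of the noise kernel.
    Up to [1 - rho], this is the [j]-th term of [deriv_noise_kernel]. *)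
Lemma randomized_sign_kernel (e d : cube n) (rho : R) (j : 'I_n) :
  \sum_(a : cube n * cube n) mask_weight rho a.1 * (2 ^+ n)^-1 *
      ((a.1 j)%:R * rademacher R a.2 j) * (resample a.1 a.2 e == d)%:R =
  (1 - rho) * (2^-1 * sign_product e d j *
     \prod_(i | i != j) (2^-1 * (1 + sign_product e d i * rho))).
Proof.
(* the contribution of coordinate [i] when its mask is [h] and its sign is [b] *)
pose c (i : 'I_n) (h b : bool) : R :=
  (if h then 1 - rho else rho) * 2^-1 * (if i == j then h%:R * (-1) ^+ b else 1)
  * (e i (+) (h && b) == d i)%:R.
have -> : \sum_(a : cube n * cube n) mask_weight rho a.1 * (2 ^+ n)^-1 *
      ((a.1 j)%:R * rademacher R a.2 j) * (resample a.1 a.2 e == d)%:R =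
    \sum_(eta : cube n) \sum_(s : cube n) \prod_i c i (eta i) (s i).
  rewrite pair_big /=; apply: eq_bigr => -[eta s] _ /=.
  rewrite /c !big_split /=; congr (_ * _ * _ * _).
  - by rewrite prodr_const card_ord exprVn.
  - by rewrite (bigD1 j)//= eqxx big1 ?mulr1// => i /negbTE ->.
  - have [<-|] := eqVneq (resample eta s e) d.
      by rewrite big1// => i _; rewrite ffunE eqxx.
    move=> rd; have [i ei] : exists i, resample eta s e i != d i.
      apply/existsP; apply: contraNT rd; rewrite negb_exists => /forallP h.
      by apply/eqP/ffunP => i; have := h i; rewrite negbK => /eqP.
    by rewrite ffunE in ei; rewrite (bigD1 i)//= (negbTE ei) mul0r.
have -> : \sum_(eta : cube n) \sum_(s : cube n) \prod_i c i (eta i) (s i) =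
    \sum_(eta : cube n) \prod_i \sum_b c i (eta i) b.
  by apply: eq_bigr => eta _; rewrite bigA_distr_bigA.
rewrite -(bigA_distr_bigA (fun i (h : bool) => \sum_b c i h b)).
rewrite (bigD1 j)//= !mulrA; congr (_ * _).
  rewrite !big_bool /c eqxx /sign_product.
  by case: (e j) (d j) => [] [] /=; ring.
apply: eq_bigr => i /negbTE ij; rewrite !big_bool /c ij /sign_product.
by case: (e i) (d i) => [] [] /=; field.
Qed.

Context (X : normedModType R).

(** Flipping [s_j] flips coordinate [j] of the resampled point and changes the
    sign of the weight, so the two halves of [D_j g] have the same signed
    sum. *)
Lemma sum_signed_cubeD (j : 'I_n) (eta e : cube n) (g : cube n -> X) :
  \sum_s ((eta j)%:R * rademacher R s j) *: cubeD j g (resample eta s e) =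
  \sum_s ((eta j)%:R * rademacher R s j) *: g (resample eta s e).
Proof.
case etaj: (eta j); last by rewrite !big1// => s _; rewrite mul0r scale0r.
have flipped : \sum_s (true%:R * rademacher R s j) *: g (flip j (resample eta s e)) =
    - \sum_s (true%:R * rademacher R s j) *: g (resample eta s e).
  rewrite (reindex_inj (inv_inj (flipK j))) -sumrN /=; apply: eq_bigr => s _.
  rewrite rademacher_flip mulrN scaleNr; congr (- (_ *: g _)).
  apply/ffunP => i; rewrite !ffunE; case: eqP => // ->.
  by rewrite etaj /=; case: (e j) (s j) => [] [].
under eq_bigr do rewrite /cubeD scalerA mulrC -scalerA scalerBr.
by rewrite -scaler_sumr sumrB flipped opprK scaler_half_double.
Qed.

Definition noise (rho : R) (g : cube n -> X) (e : cube n) : X :=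
  \sum_d (noise_kernel e d).[rho] *: g d.

Definition noise_deriv (rho : R) (g : cube n -> X) (e : cube n) : X :=
  \sum_d (noise_kernel e d)^`().[rho] *: g d.

Lemma noise1 (g : cube n -> X) (e : cube n) : noise 1 g e = g e.
Proof.
rewrite /noise (bigD1 e)//= noise_kernel1 eqxx scale1r big1 ?addr0// => d de.
by rewrite noise_kernel1 eq_sym (negbTE de) scale0r.
Qed.

Lemma noise0_odd (g : cube n -> X) (e : cube n) :
  (forall d, g (antipode d) = - g d) -> noise 0 g e = 0.
Proof.
move=> g_odd; rewrite /noise; under eq_bigr do rewrite noise_kernel0.
rewrite -scaler_sumr; set S := \sum_d g d.
have SN : S = - S.
  rewrite {1}/S (reindex_inj (inv_inj antipodeK)) /= -sumrN.
  by apply: eq_bigr => d _; exact: g_odd.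
by rewrite -[S]scaler_half_double {2}SN subrr !scaler0.
Qed.

(** The probabilistic form of the derivative of the noise operator; both sides
    have the same coefficient at each value [g d]. *)
Lemma noise_deriv_randomized (rho : R) (g : cube n -> X) (e : cube n) :
  \sum_(a : cube n * cube n) (mask_weight rho a.1 * (2 ^+ n)^-1) *:
      (\sum_j ((a.1 j)%:R * rademacher R a.2 j) *: cubeD j g (resample a.1 a.2 e))
  = (1 - rho) *: noise_deriv rho g e.
Proof.
pose w (a : cube n * cube n) : R := mask_weight rho a.1 * (2 ^+ n)^-1.
pose v (a : cube n * cube n) j : R := (a.1 j)%:R * rademacher R a.2 j.
transitivity (\sum_a \sum_j (w a * v a j) *: g (resample a.1 a.2 e)).
  have sumsum (h : 'I_n -> cube n -> cube n -> X) :
      \sum_a w a *: (\sum_j v a j *: h j a.1 a.2) =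
      \sum_j \sum_eta (mask_weight rho eta * (2 ^+ n)^-1) *:
        \sum_s v (eta, s) j *: h j eta s.
    under eq_bigr do rewrite scaler_sumr.
    rewrite exchange_big; apply: eq_bigr => j _ /=.
    under [RHS]eq_bigr do rewrite scaler_sumr.
    by rewrite pair_big; apply: eq_bigr => -[].
  rewrite (sumsum (fun j eta s => cubeD j g (resample eta s e))).
  under eq_bigr do under eq_bigr do rewrite sum_signed_cubeD.
  rewrite -(sumsum (fun j eta s => g (resample eta s e))).
  apply: eq_bigr => a _; rewrite scaler_sumr.
  by apply: eq_bigr => j _; rewrite scalerA.
transitivity (\sum_d (\sum_j \sum_a
    w a * v a j * (resample a.1 a.2 e == d)%:R) *: g d).
  transitivity (\sum_d \sum_j \sum_a
      (w a * v a j * (resample a.1 a.2 e == d)%:R) *: g d); last first.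
    apply: eq_bigr => d _; rewrite scaler_suml.
    by apply: eq_bigr => j _; rewrite scaler_suml.
  rewrite exchange_big [RHS]exchange_big; apply: eq_bigr => j _ /=.
  rewrite [RHS]exchange_big; apply: eq_bigr => a _ /=.
  rewrite (bigD1 (resample a.1 a.2 e))//= eqxx mulr1 big1 ?addr0// => d.
  by rewrite eq_sym => /negbTE ->; rewrite mulr0 scale0r.
rewrite /noise_deriv scaler_sumr; apply: eq_bigr => d _.
rewrite scalerA deriv_noise_kernel mulr_sumr; congr (_ *: _).
by apply: eq_bigr => j _; rewrite randomized_sign_kernel.
Qed.

Context (p : R).
Context (p_ge1 : 1 <= p).

Lemma lpnorm_noise_deriv (C rho : R) (g : cube n -> X) :
  (0 < n)%N -> rademacher_type_const X p C -> 0 <= rho < 1 ->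
  lpnorm p (noise_deriv rho g) <= (1 - rho)^-1 * (1 - rho) `^ p^-1 *
    (C * (\sum_j cubeE (fun e => `|cubeD j g e| `^ p)) `^ p^-1).
Proof.
move=> n0 typeC /andP[r0 r1].
have q0 : 0 < 1 - rho by rewrite subr_gt0.
have C0 : 0 <= C by apply/ltW; case: typeC.
set S := \sum_j _.
have S0 : 0 <= S.
  by apply: sumr_ge0 => j _; apply: cubeE_ge0 => e; exact: powR_ge0.
have rho01 : 0 <= rho <= 1 by rewrite r0 ltW.
have := randomized_gradient_bound p_ge1 g n0 typeC rho01; rewrite -/S.
under eq_cubeE do rewrite noise_deriv_randomized.
move=> /(ler_powRV p_ge1 (cubeE_ge0 (fun e => powR_ge0 _ _))).
rewrite -/(lpnorm p (fun e => (1 - rho) *: noise_deriv rho g e)) lpnormZ//.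
rewrite gtr0_norm//.
rewrite [X in _ <= X](_ : _ = C * ((1 - rho) `^ p^-1 * S `^ p^-1)); last first.
  rewrite powRM ?powR_ge0 ?(mulr_ge0 (ltW q0))// powRKV//.
  by rewrite powRM// (ltW q0).
move=> h.
rewrite -mulrA ler_pdivlMl//; apply: le_trans h _.
by rewrite mulrCA.
Qed.

(** The kernel is polynomial in [rho], and the cube is finite, so a single
    constant controls all quadratic remainders. *)
Lemma noise_increment (g : cube n -> X) : exists M, forall a b,
  0 <= a -> a < b -> b <= 1 -> lpnorm p (fun e => noise b g e - noise a g e) <=
    (b - a) * lpnorm p (noise_deriv a g) + M * (b - a) ^+ 2.
Proof.
have [M MP] := choice (fun ed : cube n * cube n =>
  horner_quadratic_remainder (noise_kernel ed.1 ed.2)).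
exists (\sum_ed `|M ed| * `|g ed.2|) => a b a0 ab b1.
have a01 : 0 <= a <= 1 by rewrite a0 (le_trans (ltW ab)).
have b01 : 0 <= b <= 1 by rewrite b1 (le_trans a0 (ltW ab)).
(* the error of the first-order expansion at [a] *)
pose r e := noise b g e - noise a g e - (b - a) *: noise_deriv a g e.
have -> : (fun e => noise b g e - noise a g e) =
    (fun e => (b - a) *: noise_deriv a g e + r e).
  by apply/funext => e; rewrite /r subrKC.
apply: le_trans (lpnormD p_ge1 _ _) _.
rewrite lpnormZ// gtr0_norm ?subr_gt0// lerD2l.
apply: lpnorm_le_sup => // e.
have -> : r e = \sum_d ((noise_kernel e d).[b] - (noise_kernel e d).[a] -
    (b - a) * (noise_kernel e d)^`().[a]) *: g d.
  rewrite /r /noise /noise_deriv scaler_sumr -!sumrB.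
  by apply: eq_bigr => d _; rewrite scalerA -!scalerBl.
apply: le_trans (ler_norm_sum _ _ _) _.
have -> : \sum_ed `|M ed| * `|g ed.2| =
    \sum_e' \sum_d `|M (e', d)| * `|g d|.
  by rewrite pair_big; apply: eq_bigr => -[].
rewrite mulr_suml [X in _ <= X](bigD1 e)//=; apply: ler_wpDr.
  by apply: sumr_ge0 => e' _; rewrite mulr_ge0 ?sqr_ge0 ?sumr_ge0.
rewrite mulr_suml; apply: ler_sum => d _.
rewrite normrZ mulrAC ler_wpM2r//.
apply: le_trans (MP (e, d) a b a01 b01) _.
by rewrite ler_wpM2r ?sqr_ge0// ler_norm.
Qed.

(** The Lp norm of [noise rho g] runs from [0] to the norm of [g], and its
    growth is dominated by that of [- p C D (1 - rho)^(1/p)], whose total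
    increase is [p C D]. *)
Lemma odd_lpnorm_le_gradient (C : R) (g : cube n -> X) :
  (0 < n)%N -> rademacher_type_const X p C ->
  (forall e, g (antipode e) = - g e) ->
  lpnorm p g <= p * C * (\sum_j cubeE (fun e => `|cubeD j g e| `^ p)) `^ p^-1.
Proof.
move=> n0 typeC g_odd; move DE: (_ `^ p^-1) => D.
have C0 : 0 <= C by apply/ltW; case: typeC.
have pV0 : p^-1 != 0 by rewrite invr_eq0 gt_eqF// (lt_le_trans ltr01).
have D0 : 0 <= D by rewrite -DE powR_ge0.
have [M MP] := noise_increment g.
(* the norm of the noised function minus its majorant, which is to decrease *)
pose h rho := lpnorm p (noise rho g) + p * C * D * (1 - rho) `^ p^-1.
have : h 1 <= h 0.
  apply: (le_of_quadratic_increments (M := M)) => a b a0 ab b1.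
  have incr : lpnorm p (noise b g) - lpnorm p (noise a g) <=
      lpnorm p (fun e => noise b g e - noise a g e).
    rewrite lerBlDr addrC; apply: le_trans _ (lpnormD p_ge1 _ _).
    rewrite le_eqVlt; apply/orP; left; apply/eqP/eq_lpnorm => e.
    by rewrite subrKC.
  have a01 : 0 <= a < 1 by rewrite a0 (lt_le_trans ab).
  have drv := lpnorm_noise_deriv g n0 typeC a01; rewrite DE in drv.
  have u0 : 0 < 1 - a by rewrite subr_gt0 (lt_le_trans ab).
  have v0 : 0 <= 1 - b by rewrite subr_ge0.
  have vu : 1 - b <= 1 - a by rewrite lerD2l lerN2 ltW.
  have := concave_powRV_increment p_ge1 u0 v0 vu.
  have -> : 1 - a - (1 - b) = b - a by ring.
  move=> /(ler_wpM2r (mulr_ge0 C0 D0)) tele.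
  have ba0 : 0 <= b - a by rewrite subr_ge0 ltW.
  have {}drv := ler_wpM2l ba0 drv.
  have {}MP := MP a b a0 ab b1.
  rewrite /h opprD addrACA -lerBrDr; apply: le_trans incr _.
  apply: le_trans MP _; rewrite [leLHS]addrC lerD2l; apply: le_trans drv _.
  apply: le_trans (_ : _ <= (b - a) * ((1 - a)^-1 * (1 - a) `^ p^-1) * (C * D)) _.
    by rewrite mulrA.
  apply: le_trans tele _; rewrite le_eqVlt; apply/orP; left; apply/eqP.
  by ring.
have N1 : lpnorm p (noise 1 g) = lpnorm p g.
  by apply: eq_lpnorm => e; exact: noise1.
have N0 : lpnorm p (noise 0 g) = 0.
  apply/eqP; rewrite eq_le lpnorm_ge0 andbT.
  by apply: (lpnorm_le_sup p_ge1) => e; rewrite (noise0_odd e g_odd) normr0.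
rewrite /h N1 N0 subrr (powR0 pV0).
have -> : (1 - 0 : R) `^ p^-1 = 1 by rewrite subr0 powR1.
move: (lpnorm p g) => N.
by rewrite mulr0 addr0 add0r mulr1.
Qed.

End NoiseKernel.

(** * Comparison of the two types *)

Section TypeConstants.
Context {R : realType} (X : normedModType R) (p : R).
Context (p_ge1 : 1 <= p).

(** The odd part is the average of [f] and [- f \o antipode]; the antipode
    commutes with flips and preserves the uniform measure. *)
Lemma cubeD_odd_part n (f : cube n -> X) (j : 'I_n) :
  cubeE (fun e => `|cubeD j (fun e' => 2^-1 *: (f e' - f (antipode e'))) e| `^ p)
  <= cubeE (fun e => `|cubeD j f e| `^ p).
Proof.
pose g e' := 2^-1 *: (f e' - f (antipode e')).
rewrite -(lpnorm_powR p_ge1 (cubeD j g)) -(lpnorm_powR p_ge1 (cubeD j f)).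
apply: (ler_powRp p_ge1 (lpnorm_ge0 _ _)).
have -> : cubeD j g =
    (fun e => 2^-1 *: (cubeD j f e + (-1) *: (cubeD j f \o @antipode n) e)).
  apply/funext => e; rewrite /cubeD /g /= antipode_flip scaleN1r -!scalerBr.
  by congr (_ *: (_ *: _)); rewrite !opprD addrACA.
rewrite lpnormZ// ger0_norm ?invr_ge0// ler_pdivrMl//.
apply: le_trans (lpnormD p_ge1 _ _) _.
rewrite (lpnormZ p_ge1 (-1)) normrN normr1 mul1r.
rewrite lpnorm_reindex; last exact: inv_inj antipodeK.
by rewrite mulr_natl mulr2n.
Qed.

Lemma rademacher_enflo (C : R) :
  rademacher_type_const X p C -> enflo_type_const X p (p * C).
Proof.
have p0 : 0 < p by exact: lt_le_trans p_ge1.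
move=> typeC; have C0 : 0 < C by case: typeC.
split=> [|n f n0]; first exact: mulr_gt0.
set g := fun e => 2^-1 *: (f e - f (antipode e)).
have g_odd e : g (antipode e) = - g e.
  by rewrite /g antipodeK -scalerN opprB.
set S := \sum_j _.
have S0 : 0 <= S.
  by apply: sumr_ge0 => j _; apply: cubeE_ge0 => e; exact: powR_ge0.
rewrite -(lpnorm_powR p_ge1 g) -[S](powRVK p_ge1)//.
rewrite -powRM ?powR_ge0 ?(ltW (mulr_gt0 p0 C0))//.
apply: (ler_powRp p_ge1 (lpnorm_ge0 _ _)).
apply: le_trans (odd_lpnorm_le_gradient p_ge1 n0 typeC g_odd) _.
apply: ler_wpM2l; first exact: ltW (mulr_gt0 p0 C0).
apply: ler_powRV => //.
  by apply: sumr_ge0 => j _; apply: cubeE_ge0 => e; exact: powR_ge0.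
by apply: ler_sum => j _; exact: cubeD_odd_part.
Qed.

Lemma enflo_rademacher (C : R) :
  enflo_type_const X p C -> rademacher_type_const X p C.
Proof.
move=> [C0 enfloC]; split=> // n x n0.
pose f (e : cube n) : X := \sum_(j < n) rademacher R e j *: x j.
have f_odd e : 2^-1 *: (f e - f (antipode e)) = f e.
  have -> : f (antipode e) = - f e.
    rewrite /f -sumrN; apply: eq_bigr => j _.
    by rewrite rademacher_antipode scaleNr.
  by rewrite opprK scaler_half_double.
have fD j e : cubeD j f e = rademacher R e j *: x j.
  rewrite /cubeD /f -sumrB (bigD1 j)//= big1 => [|i ij]; last first.
    by rewrite rademacher_flip_neq// subrr.
  by rewrite rademacher_flip scaleNr opprK addr0 scaler_half_double.
have := enfloC n f n0.
under eq_cubeE do rewrite f_odd.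
move=> /le_trans; apply; rewrite ler_wpM2l ?powR_ge0//; apply: ler_sum => j _.
under eq_cubeE do rewrite fD normrZ /rademacher normr_sign mul1r.
by rewrite cubeE_cst.
Qed.

End TypeConstants.

Theorem corollary3p1 (R : realType) (X : completeNormedModType R) (p : R)
    (p_ge1 : 1 <= p) (p_le2 : p <= 2) :
  [/\ (rademacher_const X p <= enflo_const X p)%E,
      (enflo_const X p <= p%:E * rademacher_const X p)%E
    & has_rademacher_type X p <-> has_enflo_type X p].
Proof.
have p0 : 0 < p by exact: lt_le_trans p_ge1.
split.
- apply: ereal_inf_le_tmp => _ [C enfloC <-].
  by exists C => //; exact: enflo_rademacher.
- rewrite -lee_pdivrMl//; apply: le_ereal_inf_tmp => _ [C typeC <-].
  rewrite lee_pdivrMl//; apply: ereal_inf_lbound.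
  by exists (p * C); [exact: rademacher_enflo|rewrite EFinM].
- split=> -[C].
  + by move=> /(rademacher_enflo p_ge1); exists (p * C).
  + by move=> /enflo_rademacher; exists C.
Qed.
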